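(* Min-VB-SM Probabilistic Lobbying (defined in the context) can be approximated in polynomial time within a factor of $\ln(N)+1$, where $N$ is the strict cover number of the given instance.
   Context: Probabilistic lobbying setting. There are $m$ voters $v_1,\dots,v_m$ and $n$ issues $r_1,\dots,r_n$. A probability matrix $P=(p_{i,j})\in(\mathbb{Q}\cap[0,1])^{m\times n}$ gives the probability that $v_i$ votes ''yes'' on $r_j$. A discretization level $k\in\mathbb{N}$ is chosen so that $k+1$ is a common multiple of the denominators of all $p_{i,j}$; admissible probability values are $0,\frac1{k+1},\dots,1$. For each $(i,j)$ a price function $c_{i,j}:\{0,\frac1{k+1},\dots,1\}\to\mathbb{N}$ with $c_{i,j}(p_{i,j})=0$, monotone in the sense that $p_{i,j}\le a\le b$ or $p_{i,j}\ge a\ge b$ implies $c_{i,j}(a)\le c_{i,j}(b)$, gives the price of changing $v_i$'s probability on $r_j$ to $a$; these form a cost matrix $C_P$. The Lobby has a target vector $\vec Z\in\{0,1\}^n$; a threshold $t\in\mathbb{Q}\cap[0,1]$ is given. Voter $v_i$ favors the agenda on $r_j$ if his probability of voting $Z_j$ ($p_{i,j}$ if $Z_j=1$, $1-p_{i,j}$ if $Z_j=0$) exceeds $t$. Strict majority (SM): $r_j$ is won iff strictly more than $m/2$ voters favor the agenda on it. Voter bribery: The Lobby chooses an amount $d_i\ge0$ per voter; $d_i$ is split equally among the $n$ issues, and for each $j$ the probability of $v_i$ on $r_j$ moves toward $Z_j$ to the farthest admissible value $a$ with $c_{i,j}(a)\le d_i/n$; its cost is $\sum_i d_i$. Min-VB-SM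 Probabilistic Lobbying: given $P,C_P,\vec Z$ (and $t$), find a voter bribery of minimum total cost making every issue won under SM. The strict cover number of issue $r_j$ is the number of additional voters who must be brought to favor the agenda on $r_j$ for a strict majority, i.e. $\max(0,\lfloor m/2\rfloor+1-f_j)$ where $f_j$ is the number of voters currently favoring the agenda on $r_j$; the strict cover number $N$ of the instance is the sum of these over all issues. *)

(* Defs.v *)
From HB Require Import structures.
From mathcomp Require Import all_boot all_order all_algebra.
From mathcomp Require Import reals exp.

Set Implicit Arguments.
Unset Strict Implicit.
Unset Printing Implicit Defensive.

Import Order.TTheory GRing.Theory Num.Theory.
Local Open Scope ring_scope.

(******************************************************************************)
(* Polynomial time is measured on a random access machine with the arithmetic *)
(* of Aho, Hopcroft and Ullman (+, -, *, /) and the logarithmic cost          *)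
(* criterion, programmed with structured control flow.  Instead of one bank   *)
(* of registers there are several, each with unboundedly many registers       *)
(* holding natural numbers: register i of bank b of the store s is s b i.  A  *)
(* program mentions finitely many banks, and every register index and every   *)
(* intermediate value is charged its bit length, so that these machines and   *)
(* multitape Turing machines simulate each other with polynomial overhead.    *)
(******************************************************************************)

Inductive binop := Add | Sub | Mul | Div.

Inductive expr :=
  | Cst of nat
  | Get of nat & expr
  | Bin of binop & expr & expr.

Inductive cmd :=
  | Skip
  | Assign of nat & expr & expr
  | Seq of cmd & cmd
  | If of expr & cmd & cmd
  | While of expr & cmd.

Definition store := nat -> nat -> nat.

(* Subtraction is truncated and division by 0 returns 0. *)
Definition eval_binop (o : binop) (x y : nat) : nat :=
  match o with
  | Add => (x + y)%N
  | Sub => (x - y)%N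
  | Mul => (x * y)%N
  | Div => (x %/ y)%N
  end.

Fixpoint eval (s : store) (e : expr) : nat :=
  match e with
  | Cst x => x
  | Get b e1 => s b (eval s e1)
  | Bin o e1 e2 => eval_binop o (eval s e1) (eval s e2)
  end.

(* Length of the binary notation of x, with one digit for 0. *)
Definition bits (x : nat) : nat := (trunc_log 2 x).+1.

Definition word_size (w : seq nat) : nat := (\sum_(x <- w) bits x)%N.

(* The cost of e is at least the bit length of its value. *)
Fixpoint eval_cost (s : store) (e : expr) : nat :=
  match e with
  | Cst x => bits x
  | Get b e1 => (eval_cost s e1 + bits (eval s e))%N
  | Bin o e1 e2 => (eval_cost s e1 + eval_cost s e2 + bits (eval s e))%N
  end.

Definition update (s : store) (b i x : nat) : store :=
  fun b' i' => if (b' == b) && (i' == i) then x else s b' i'.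

(* exec c s s' T: from the store s the program c halts in the store s', at    *)
(* total cost T.  Nonzero values count as true.                               *)
Inductive exec : cmd -> store -> store -> nat -> Prop :=
  | ExecSkip s : exec Skip s s 1
  | ExecAssign s b ei ex :
      exec (Assign b ei ex) s (update s b (eval s ei) (eval s ex))
           (eval_cost s ei + eval_cost s ex)
  | ExecSeq c1 c2 s1 s2 s3 T1 T2 :
      exec c1 s1 s2 T1 -> exec c2 s2 s3 T2 ->
      exec (Seq c1 c2) s1 s3 (T1 + T2)
  | ExecIfTrue e c1 c2 s s' T :
      eval s e <> 0%N -> exec c1 s s' T ->
      exec (If e c1 c2) s s' (eval_cost s e + T)
  | ExecIfFalse e c1 c2 s s' T :
      eval s e = 0%N -> exec c2 s s' T ->
      exec (If e c1 c2) s s' (eval_cost s e + T)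
  | ExecWhileTrue e c s1 s2 s3 T1 T2 :
      eval s1 e <> 0%N -> exec c s1 s2 T1 -> exec (While e c) s2 s3 T2 ->
      exec (While e c) s1 s3 (eval_cost s1 e + T1 + T2)
  | ExecWhileFalse e c s :
      eval s e = 0%N -> exec (While e c) s s (eval_cost s e).

(* The input word is in bank 0, followed by zeros; all other banks are zero.  *)
Definition input_store (w : seq nat) : store :=
  fun b i => if b == 0%N then nth 0%N w i else 0%N.

(* The output word is read from bank 1. *)
Definition outputs (s : store) (w : seq nat) : Prop :=
  forall i, (i < size w)%N -> s 1%N i = nth 0%N w i.

(* Solutions may be real-valued, so the words standing for a solution are     *)
(* given by a relation.                                                       *)
Record min_problem (R : realType) := MinProblem {
  instance : Type;
  encode : instance -> seq nat;
  solution : instance -> Type;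
  represents : forall x : instance, seq nat -> solution x -> Prop;
  feasible : forall x : instance, solution x -> Prop;
  cost : forall x : instance, solution x -> R
}.

(* The program must meet the time bound on every instance; on instances       *)
(* without feasible solutions its output is unconstrained.                    *)
Definition poly_time_approximable (R : realType) (Q : min_problem R)
    (ratio : instance Q -> R) : Prop :=
  exists (c : cmd) (pol : {poly nat}), forall x : instance Q,
  exists (s : store) (T : nat),
    [/\ exec c (input_store (encode x)) s T,
        (T <= pol.[word_size (encode x)])%N
      & (exists z : solution x, feasible z) ->
        exists (w : seq nat) (y : solution x),
          [/\ outputs s w, represents w y, feasible y
            & forall z : solution x, feasible z ->
                cost y <= ratio x * cost z] ].

Definition admissible (k : nat) (a : 'I_k.+2) : rat := a%:R / k.+1%:R.

(* price i j a is the price of the admissible probability a / (k + 1); it     *)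
(* is part of the input as an explicit table with k + 2 entries.              *)
Record lobbying := Lobbying {
  nvoters : nat;
  nissues : nat;
  level : nat;
  prob : 'I_nvoters -> 'I_nissues -> rat;
  price : 'I_nvoters -> 'I_nissues -> 'I_level.+2 -> nat;
  target : 'I_nissues -> bool;
  threshold : rat;
  nissues_gt0 : (0 < nissues)%N;
  prob01 : forall i j, 0 <= prob i j <= 1;
  level_denq : forall i j, (denq (prob i j) %| level.+1%:Z)%Z;
  price_prob : forall i j a, admissible a = prob i j -> price i j a = 0%N;
  price_mono : forall i j a b,
    (prob i j <= admissible a <= admissible b) \/
    (admissible b <= admissible a <= prob i j) ->
    (price i j a <= price i j b)%N;
  threshold01 : 0 <= threshold <= 1
}.

Section Lobbying.

Variables (R : realType) (L : lobbying).

Local Notation m := (nvoters L).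
Local Notation n := (nissues L).

Definition favors (q : 'I_m -> 'I_n -> rat) (i : 'I_m) (j : 'I_n) : bool :=
  threshold L < (if target j then q i j else 1 - q i j).

Definition num_favoring (q : 'I_m -> 'I_n -> rat) (j : 'I_n) : nat :=
  #|[set i : 'I_m | favors q i j]|.

Definition won_SM (q : 'I_m -> 'I_n -> rat) (j : 'I_n) : Prop :=
  m%:R / 2 < (num_favoring q j)%:R :> rat.

(* Starting the maximum (minimum) at prob i j discards the values that lie    *)
(* on the other side of prob i j than the target.                             *)
Definition bribed (d : 'I_m -> R) (i : 'I_m) (j : 'I_n) : rat :=
  if target j then
    \big[Order.max/prob i j]_(a | (price i j a)%:R <= d i / n%:R) admissible a
  else
    \big[Order.min/prob i j]_(a | (price i j a)%:R <= d i / n%:R) admissible a.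

Definition VB_SM_feasible (d : 'I_m -> R) : Prop :=
  (forall i, 0 <= d i) /\ (forall j, won_SM (bribed d) j).

Definition VB_cost (d : 'I_m -> R) : R := \sum_i d i.

(* Truncated subtraction gives max(0, _).  If the sum is 0, then paying       *)
(* nothing is optimal, so the value of ln 0 does not affect the ratio         *)
(* ln N + 1.                                                                  *)
Definition strict_cover_number : nat :=
  (\sum_(j < n) ((m./2).+1 - num_favoring (@prob L) j))%N.

Definition encode_rat (x : rat) : seq nat := [:: `|numq x|%N; `|denq x|%N].

Definition encode_lobbying : seq nat :=
  [:: m; n; level L] ++ encode_rat (threshold L)
  ++ [seq nat_of_bool (target j) | j <- enum 'I_n]
  ++ flatten [seq encode_rat (prob i j) | i <- enum 'I_m, j <- enum 'I_n]
  ++ flatten [seq [seq price i j a | a <- enum 'I_(level L).+2]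
             | i <- enum 'I_m, j <- enum 'I_n].

(* Amounts are output as fractions. *)
Definition represents_bribery (w : seq nat) (d : 'I_m -> R) : Prop :=
  size w = m.*2 /\
  forall i : 'I_m,
    (0 < nth 0%N w i.*2.+1)%N /\
    d i = (nth 0%N w i.*2)%:R / (nth 0%N w i.*2.+1)%:R.

End Lobbying.

Definition Min_VB_SM (R : realType) : min_problem R :=
  {| instance := lobbying;
     encode := encode_lobbying;
     solution := fun L => 'I_(nvoters L) -> R;
     represents := @represents_bribery R;
     feasible := @VB_SM_feasible R;
     cost := @VB_cost R |}.

(* Main.v *)
Require Import Defs.
From HB Require Import structures.
From mathcomp Require Import all_boot all_order all_algebra.
From mathcomp Require Import boolp reals exp.
From mathcomp Require Import zify lra.

Set Implicit Arguments.
Unset Strict Implicit.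
Unset Printing Implicit Defensive.

Import Order.TTheory GRing.Theory Num.Theory.
Local Open Scope ring_scope.

(* Voter i favors issue j after receiving d_i iff d_i / n reaches the least
   price of a favorable probability, so only those m n thresholds matter and
   the problem is a covering problem with nested sets for each voter.  Greedy
   raises one voter to one threshold, minimizing the increment c per unit of
   newly covered demand g.  Let r be the residual demand.  Raising every
   voter to his amount in a solution of cost OPT covers all of r, so some
   raise, hence the greedy one, has c / g <= OPT / r.  As
   g / r <= ln r - ln (r - g), the costs telescope to at most
   OPT (ln N - ln r) until the last raise, which costs at most OPT.

   For the running time, the algorithm only copies values and increments
   counters, apart from the output, so that registers grow at most linearly
   in the number of steps; the number of steps is polynomial since every loop
   bound is a function of the input. *)

(** * Programs with bounded loops *)

Local Notation Var v := (Get v (Cst 0)).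

Inductive prog :=
  | PAssign of nat & expr & expr
  | PSeq of prog & prog
  | PIf of expr & prog
  | PFor of nat & expr & prog.

Fixpoint compile (p : prog) : cmd :=
  match p with
  | PAssign b ei ex => Assign b ei ex
  | PSeq p1 p2 => Seq (compile p1) (compile p2)
  | PIf e p1 => If e (compile p1) Skip
  | PFor v e p1 =>
      Seq (Assign v (Cst 0) (Cst 0))
          (While (Bin Defs.Sub e (Var v))
                 (Seq (compile p1) (Assign v (Cst 0) (Bin Add (Var v) (Cst 1)))))
  end.

(** A loop bound is evaluated once here but at every test in [compile]. Both agree for [tame]
    programs: their bounds read only the input bank, which they never write. *)
Fixpoint run (p : prog) (s : store) : store :=
  match p with
  | PAssign b ei ex => update s b (eval s ei) (eval s ex)
  | PSeq p1 p2 => run p2 (run p1 s)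
  | PIf e p1 => if eval s e == 0%N then s else run p1 s
  | PFor v e p1 =>
      iter (eval s e) (fun s' => update (run p1 s') v 0 (s' v 0%N).+1)
           (update s v 0 0)
  end.

Fixpoint writes (b : nat) (p : prog) : bool :=
  match p with
  | PAssign b' _ _ => b' == b
  | PSeq p1 p2 => writes b p1 || writes b p2
  | PIf _ p1 => writes b p1
  | PFor v _ p1 => (v == b) || writes b p1
  end.

Fixpoint reads (b : nat) (e : expr) : bool :=
  match e with
  | Cst _ => false
  | Get b' e1 => (b' == b) || reads b e1
  | Bin _ e1 e2 => reads b e1 || reads b e2
  end.

Fixpoint input_only (e : expr) : bool :=
  match e with
  | Cst _ => true
  | Get b e1 => (b == 0%N) && input_only e1
  | Bin _ e1 e2 => input_only e1 && input_only e2
  end.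

(* The value exceeds the largest register value read by at most 1. *)
Fixpoint slow (e : expr) : bool :=
  match e with
  | Cst x => (x <= 1)%N
  | Get _ _ => true
  | Bin Defs.Sub e1 _ => slow e1
  | Bin Add (Get _ _) (Cst x) => (x <= 1)%N
  | _ => false
  end.

(* Products may only be stored in the output bank 1, which is never read; all
   other registers grow by at most 1 per assignment.  Loop bounds depend on the
   input only, so that iteration counts are known in advance. *)
Fixpoint tame (p : prog) : bool :=
  match p with
  | PAssign b ei ex =>
      [&& b != 0%N, ~~ reads 1 ei, ~~ reads 1 ex & (b == 1%N) || slow ex]
  | PSeq p1 p2 => tame p1 && tame p2
  | PIf e p1 => ~~ reads 1 e && tame p1
  | PFor v e p1 =>
      [&& v != 0%N, v != 1%N, input_only e, ~~ writes v p1 & tame p1]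
  end.

(** Bounds of nested loops, too, are evaluated in the initial store [s]; [input_only] makes this
    legitimate. *)
Fixpoint loops_bounded (s : store) (S : nat) (p : prog) : bool :=
  match p with
  | PAssign _ _ _ => true
  | PSeq p1 p2 => loops_bounded s S p1 && loops_bounded s S p2
  | PIf _ p1 => loops_bounded s S p1
  | PFor _ e p1 => (eval s e <= S)%N && loops_bounded s S p1
  end.

(** Measured in units of [bits B], where [B] bounds the registers read. Doubling pays for the
    operands and for a result whose bit length is at most the sum of theirs. *)
Fixpoint weight (e : expr) : nat :=
  match e with
  | Cst x => bits x
  | Get _ e1 => (weight e1).+1
  | Bin _ e1 e2 => (weight e1 + weight e2).*2
  end.

(** Bounds the increase of the largest register outside bank 1, as a polynomial in the loop bound;
    the [+ 1] per iteration is for the counter. *)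
Fixpoint growth (p : prog) : {poly nat} :=
  match p with
  | PAssign _ _ _ => 1
  | PSeq p1 p2 => growth p1 + growth p2
  | PIf _ p1 => growth p1
  | PFor _ _ p1 => (growth p1 + 1) * 'X
  end.

(** Time in units of [bits B]. A loop pays 2 for resetting its counter, a last guard, and per
    iteration a guard, the body and the increment. *)
Fixpoint ticks (p : prog) : {poly nat} :=
  match p with
  | PAssign _ ei ex => (weight ei + weight ex)%N%:P
  | PSeq p1 p2 => ticks p1 + ticks p2
  | PIf e p1 => (weight e)%:P + ticks p1 + 1
  | PFor v e p1 =>
      let guard := (weight (Bin Defs.Sub e (Var v)))%:P in
      2%N%:P + guard
      + (guard + ticks p1 + (weight (Bin Add (Var v) (Cst 1))).+1%:P) * 'X
  end.

(** * Bit lengths and the cost of evaluation *)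

Lemma horner_add (p q : {poly nat}) x : ((p + q).[x] = p.[x] + q.[x])%N.
Proof. exact: hornerD. Qed.

Lemma horner_mul (p q : {poly nat}) x : ((p * q).[x] = p.[x] * q.[x])%N.
Proof. exact: hornerM. Qed.

Lemma horner_one x : (1 : {poly nat}).[x] = 1%N.
Proof. exact: (hornerC 1%N x). Qed.

Definition hornern := (horner_add, horner_mul, horner_one, hornerC, hornerX).

Lemma bits_gt0 x : (0 < bits x)%N. Proof. by []. Qed.

Lemma bits_mono x y : (x <= y)%N -> (bits x <= bits y)%N.
Proof. by move=> xy; rewrite /bits ltnS leq_trunc_log. Qed.

Lemma ltn_bits x : (x < 2 ^ bits x)%N.
Proof. exact: trunc_log_ltn. Qed.

Lemma bits_leq x b : (0 < b)%N -> (x < 2 ^ b)%N -> (bits x <= b)%N.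
Proof.
case: x => [|x] b0 xb; first by rewrite /bits trunc_log0.
rewrite /bits -(@ltn_exp2l 2) //; apply: leq_ltn_trans xb.
exact: trunc_logP.
Qed.

Lemma bitsM x y : (bits (x * y) <= bits x + bits y)%N.
Proof.
apply: bits_leq; first by rewrite addn_gt0.
by rewrite expnD; have := ltn_bits x; have := ltn_bits y; nia.
Qed.

Lemma bitsD x y : (bits (x + y) <= bits x + bits y)%N.
Proof.
apply: bits_leq; first by rewrite addn_gt0.
by rewrite expnD; have := ltn_bits x; have := ltn_bits y; nia.
Qed.

Lemma bits_binop o x y : (bits (eval_binop o x y) <= bits x + bits y)%N.
Proof.
case: o => /=; [exact: bitsD| |exact: bitsM|].
  by apply: leq_trans (leq_addr _ _); apply: bits_mono; apply: leq_subr.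
by apply: leq_trans (leq_addr _ _); apply: bits_mono; apply: leq_div.
Qed.

Lemma eval_cost_weight s B e : ~~ reads 1 e ->
  (forall b i, b != 1%N -> s b i <= B)%N ->
  (bits (eval s e) <= weight e * bits B)%N /\
  (eval_cost s e <= weight e * bits B)%N.
Proof.
move=> + sB; elim: e => [x|b e IHe|o e1 IH1 e2 IH2] /=.
- by rewrite leq_pmulr.
- rewrite negb_or => /andP[b1 /IHe[_ H]].
  have Hb : (bits (s b (eval s e)) <= bits B)%N by apply/bits_mono/sB.
  by split; nia.
- rewrite negb_or => /andP[/IH1[a1 c1] /IH2[a2 c2]].
  have := bits_binop o (eval s e1) (eval s e2).
  by move=> H; rewrite -muln2; split; nia.
Qed.

Lemma eval_slow s M e : (0 < M)%N -> ~~ reads 1 e -> slow e ->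
  (forall b i, b != 1%N -> s b i <= M)%N -> (eval s e <= M.+1)%N.
Proof.
move=> M0 + + sM; elim: e => [x|b e _|[] e1 IH1 e2 _] //=.
- by move=> _ x1; lia.
- by rewrite negb_or => /andP[b1 _] _; apply: leqW; apply: sM.
- case: e1 {IH1} => // b e1; case: e2 => // x /=.
  rewrite !negb_or => /andP[/andP[b1 _] _] x1.
  by have := sM b (eval s e1) b1; lia.
- by rewrite negb_or => /andP[r1 _] /(IH1 r1); apply: leq_trans; apply: leq_subr.
Qed.

(** * Frame and invariant rules; running time of bounded loops *)

Lemma eval_input_only s s' e : input_only e -> s 0%N =1 s' 0%N ->
  eval s e = eval s' e.
Proof.
move=> + ss'; elim: e => [//|b e IH|o e1 IH1 e2 IH2] /=.
  by move=> /andP[/eqP-> /IH ->].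
by move=> /andP[/IH1-> /IH2->].
Qed.

Lemma input_only_reads e : input_only e -> ~~ reads 1 e.
Proof.
elim: e => [//|b e IH|o e1 IH1 e2 IH2] /=; first by move=> /andP[/eqP->].
by rewrite negb_or => /andP[/IH1-> /IH2->].
Qed.

Lemma update_other s b i x b' i' : b' != b -> update s b i x b' i' = s b' i'.
Proof. by rewrite /update => /negbTE->. Qed.

Lemma update_same s b i x : update s b i x b i = x.
Proof. by rewrite /update !eqxx. Qed.

Lemma run_frame p b s i : ~~ writes b p -> run p s b i = s b i.
Proof.
elim: p s i => [b' ei ex|p1 IH1 p2 IH2|e p1 IH|v e p1 IH] s i /=.
- by move=> bb; rewrite update_other // eq_sym.
- by rewrite negb_or => /andP[w1 w2]; rewrite IH2 ?IH1.
- by case: eqP => // _; apply: IH.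
- rewrite negb_or => /andP[vb w].
  by elim: (eval s e) => [|k IHk] /=; rewrite update_other 1?eq_sym // IH.
Qed.

Lemma tame_frame0 p s i : tame p -> run p s 0%N i = s 0%N i.
Proof.
move=> tp; apply: run_frame; elim: p tp => //=.
- by move=> b ei ex /and4P[].
- by move=> p1 IH1 p2 IH2 /andP[/IH1 w1 /IH2 w2]; rewrite negb_or w1.
- by move=> e p1 IH /andP[_ /IH].
- by move=> v e p1 IH /and5P[/negbTE-> _ _ _ /IH].
Qed.

Section Loop.
Variables (v : nat) (e : expr) (p : prog) (s : store).
Hypotheses (v0 : v != 0%N) (tp : tame p).

Definition loop_state k : store :=
  iter k (fun s' => update (run p s') v 0 (s' v 0%N).+1) (update s v 0 0).

Lemma loop_stateS k :
  loop_state k.+1 = update (run p (loop_state k)) v 0 (loop_state k v 0%N).+1.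
Proof. by []. Qed.

Lemma loop_state_var k : loop_state k v 0%N = k.
Proof.
elim: k => [|k IH]; first by rewrite /loop_state /= update_same.
by rewrite loop_stateS update_same IH.
Qed.

Lemma loop_state_frame k b i : b != v -> ~~ writes b p ->
  loop_state k b i = s b i.
Proof.
move=> bv wb; elim: k => [|k IH]; first by rewrite /loop_state /= update_other.
by rewrite loop_stateS update_other // run_frame.
Qed.

Lemma loop_state0 k i : loop_state k 0%N i = s 0%N i.
Proof.
elim: k => [|k IH]; first by rewrite /loop_state /= update_other // eq_sym.
by rewrite loop_stateS update_other 1?eq_sym // tame_frame0.
Qed.

(** The invariant rule for loops. Banks not written by the loop may be assumed to be as before it,
    so an invariant need only mention what changes. *)
Lemma run_for (I : nat -> store -> Prop) :
  I 0%N (update s v 0 0) ->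
  (forall k s', (k < eval s e)%N -> s' v 0%N = k ->
    (forall b i, b != v -> ~~ writes b p -> s' b i = s b i) -> I k s' ->
    I k.+1 (update (run p s') v 0 k.+1)) ->
  I (eval s e) (run (PFor v e p) s).
Proof.
move=> I0 IS; suff H k : (k <= eval s e)%N -> I k (loop_state k) by apply: H.
elim: k => [//|k IH] lk; rewrite loop_stateS loop_state_var.
apply: IS => //; [exact: loop_state_var|exact: loop_state_frame|].
exact/IH/ltnW.
Qed.

End Loop.

(** [M] bounds the registers on entry and grows along the induction; [B] is fixed and bounds them up
    to the end, so that every expression costs at most its weight times [bits B]. *)
Lemma exec_compile s0 S p : tame p -> loops_bounded s0 S p ->
  forall s M B, (0 < M)%N -> s 0%N =1 s0 0%N ->
  (forall b i, b != 1%N -> s b i <= M)%N -> (M + (growth p).[S] <= B)%N ->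
  (forall b i, b != 1%N -> run p s b i <= M + (growth p).[S])%N /\
  exists2 T, exec (compile p) s (run p s) T & (T <= (ticks p).[S] * bits B)%N.
Proof.
elim: p => [b ei ex|p1 IH1 p2 IH2|e p1 IH|v e p1 IH] /=.
- move=> /and4P[b0 r1 r2 sl] _ s M B M0 _ sM; rewrite hornern => MB.
  have sB b' i : b' != 1%N -> (s b' i <= B)%N.
    by move=> /(sM _ i) /leq_trans; apply; lia.
  split.
    move=> b' i b1; rewrite /update; case: ifP => [/andP[/eqP bb _]|_]; last first.
      by rewrite (leq_trans (sM _ i b1)) // leq_addr.
    by rewrite addn1 eval_slow //; move: sl; rewrite -bb (negbTE b1).
  exists (eval_cost s ei + eval_cost s ex)%N; first exact: ExecAssign.
  have [_ c1] := eval_cost_weight r1 sB; have [_ c2] := eval_cost_weight r2 sB.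
  by rewrite hornern mulnDl leq_add.
- move=> /andP[t1 t2] /andP[l1 l2] s M B M0 s00 sM; rewrite !hornern => MB.
  have [sM1 [T1 e1 c1]] := IH1 t1 l1 s M B M0 s00 sM ltac:(lia).
  have [|||sM2 [T2 e2 c2]] := IH2 t2 l2 (run p1 s) (M + (growth p1).[S])%N B _ _ sM1.
  + by lia.
  + by move=> i; rewrite tame_frame0.
  + by lia.
  split; first by move=> b i /sM2; rewrite addnA.
  exists (T1 + T2)%N; first exact: ExecSeq e1 e2.
  by lia.
- move=> /andP[r1 t1] l1 s M B M0 s00 sM MB; rewrite !hornern.
  have sB b' i : b' != 1%N -> (s b' i <= B)%N.
    by move=> /(sM _ i) /leq_trans; apply; lia.
  have [_ c1] := eval_cost_weight r1 sB.
  have [sM1 [T e1 c]] := IH t1 l1 s M B M0 s00 sM MB.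
  case: eqP => E; split=> //.
  + by move=> b i b1; rewrite (leq_trans (sM _ i b1)) // leq_addr.
  + exists (eval_cost s e + 1)%N; last by have := bits_gt0 B; nia.
    by apply: ExecIfFalse => //; apply: ExecSkip.
  + exists (eval_cost s e + T)%N; last by nia.
    exact: ExecIfTrue.
- move=> /and5P[v0 v1 ie wv t1] /andP[lS l1] s M B M0 s00 sM; rewrite !hornern => MB.
  set N := eval s e; have NE : N = eval s0 e by apply: eval_input_only.
  rewrite -NE in lS.
  set g := (growth p1).[S] in MB *.
  pose st := loop_state v p1 s.
  rewrite -/(loop_state v p1 s N) -/(st N).
  have st0 k i : st k 0%N i = s 0%N i by rewrite /st loop_state0.
  (* The bound on [st k] reaches [k = N], but the body is run only for [k < N]: one more run could
     exceed [B]. *)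
  have stM k : (k <= N)%N ->
      (forall b i, b != 1%N -> st k b i <= M + k * (g + 1))%N /\
      ((k < N)%N -> exists2 T, exec (compile p1) (st k) (run p1 (st k)) T &
         (T <= (ticks p1).[S] * bits B)%N).
    elim: k => [|k IHk] kN.
      have H b i : b != 1%N -> (st 0%N b i <= M + 0 * (g + 1))%N.
        move=> b1; rewrite mul0n addn0 /st /loop_state /= /update.
        by case: ifP => // _; apply: sM.
      split=> // N0; rewrite mul0n addn0 in H.
      have [||//] := IH t1 l1 (st 0%N) M B M0 _ H; first by move=> i; rewrite st0.
      by rewrite -/g; clear -MB lS N0; nia.
    have [Hk _] := IHk (ltnW kN).
    have s0k : st k 0%N =1 s0 0%N by move=> i; rewrite st0.
    have [||Hk1 _] := IH t1 l1 (st k) _ B _ s0k Hk; first by lia.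
      by rewrite -/g; clear -MB lS kN; nia.
    have H b i : b != 1%N -> (st k.+1 b i <= M + k.+1 * (g + 1))%N.
      move=> b1; rewrite /st loop_stateS loop_state_var /update.
      case: ifP => _; first by nia.
      by have := Hk1 b i b1; rewrite -/g -/st; nia.
    split=> // kN'.
    have s0k1 : st k.+1 0%N =1 s0 0%N by move=> i; rewrite st0.
    have [||//] := IH t1 l1 (st k.+1) _ B _ s0k1 H; first by lia.
    by rewrite -/g; clear -MB lS kN'; nia.
  have sB k b i : (k <= N)%N -> b != 1%N -> (st k b i <= B)%N.
    by move=> kN /((stM k kN).1 b i) /leq_trans; apply; nia.
  split.
    by move=> b i /((stM N (leqnn _)).1 b i) /leq_trans; apply; nia.
  (* Induction on the number [k] of iterations left, since a derivation for [While] starts with its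
     first iteration. *)
  have wl : forall k, (k <= N)%N -> exists2 T,
      exec (While (Bin Defs.Sub e (Var v)) (Seq (compile p1)
          (Assign v (Cst 0) (Bin Add (Var v) (Cst 1))))) (st (N - k)%N) (st N) T &
      (T <= (weight (Bin Defs.Sub e (Var v)) + k * (weight (Bin Defs.Sub e (Var v)) +
         (ticks p1).[S] + (weight (Bin Add (Var v) (Cst 1))).+1)) * bits B)%N.
    have gc k : (k <= N)%N -> (eval_cost (st k) (Bin Defs.Sub e (Var v)) <=
        weight (Bin Defs.Sub e (Var v)) * bits B)%N.
      move=> kN; apply: (eval_cost_weight _ _).2; last by move=> b i; apply: sB.
      by rewrite /= !negb_or input_only_reads //= v1.
    have ge k : eval (st k) (Bin Defs.Sub e (Var v)) = (N - k)%N.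
      rewrite /= /st loop_state_var; congr (_ - _)%N.
      by apply: eval_input_only => // i; apply: loop_state0.
    elim=> [|k IHk] kN.
      rewrite subn0 mul0n addn0.
      exists (eval_cost (st N) (Bin Defs.Sub e (Var v))); last exact: gc.
      by apply: ExecWhileFalse; rewrite ge subnn.
    have [T2 e2 c2] := IHk (ltnW kN).
    have kN' : (N - k.+1 < N)%N by lia.
    have [T1 e1 c1] := (stM _ (ltnW kN')).2 kN'.
    have E : st (N - k)%N = update (run p1 (st (N - k.+1)%N)) v
        (eval (run p1 (st (N - k.+1)%N)) (Cst 0))
        (eval (run p1 (st (N - k.+1)%N)) (Bin Add (Var v) (Cst 1))).
      have -> : (N - k = (N - k.+1).+1)%N by lia.
      by rewrite /= run_frame // addn1.
    rewrite E in e2.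
    have e3 := ExecWhileTrue _ (ExecSeq e1 (ExecAssign _ _ _ _)) e2.
    eexists; first by apply: e3; rewrite ge; lia.
    have c3 : (eval_cost (run p1 (st (N - k.+1)%N)) (Bin Add (Var v) (Cst 1)) <=
        weight (Bin Add (Var v) (Cst 1)) * bits B)%N.
      rewrite [eval_cost _ _]/= run_frame //=.
      have := (@eval_cost_weight (st (N - k.+1)%N) B
        (Bin Add (Var v) (Cst 1)) _ _).2; apply=> /=.
        by rewrite (negbTE v1).
      by move=> b i; apply: sB; apply: ltnW.
    have c4 := gc _ (ltnW kN').
    have c5 : (eval_cost (run p1 (st (N - k.+1)%N)) (Cst 0) <= 1)%N by [].
    have c6 := bits_gt0 B.
    move: c1 c2 c3 c4 c5 c6.
    move: (eval_cost _ _) (eval_cost _ (Bin Add _ _)) (eval_cost _ (Cst 0)).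
    move: (weight _) (weight (Bin Add _ _)) (ticks _).[S] (bits B).
    by move=> w1 w2 tk bb x4 x3 x5; clear; nia.
  have [T e1 c1] := wl N (leqnn _).
  rewrite subnn in e1.
  have e2 := ExecSeq (ExecAssign s v (Cst 0) (Cst 0)) e1.
  exists (2 + T)%N; first exact: e2.
  apply: leq_trans (leq_add (leqnn 2) c1) _.
  have c6 := bits_gt0 B; move: c6 lS.
  change ((weight e + (bits 0).+1).*2) with (weight (Bin Defs.Sub e (Var v))).
  change (((bits 0).+1 + bits 1).*2) with (weight (Bin Add (Var v) (Cst 1))).
  move: (weight _) (weight (Bin Add _ _)) (ticks _).[S] (bits B) => w1 w2 tk bb; clear.
  set x := (w1 + tk + w2.+1)%N => b0 NS.
  have : (N * x * bb <= x * S * bb)%N by rewrite [(x * S)%N]mulnC !leq_mul.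
  by nia.
Qed.

(** With [W] the word size, inputs are at most [2 ^ W], so all registers outside bank 1 stay within
    [2 ^ W + (growth p).[W]]. Its bit length is at most [W + (growth p).[W] + 2], the second factor
    of the polynomial. *)
Lemma prog_poly_time p : tame p -> exists pol : {poly nat}, forall w,
  loops_bounded (input_store w) (word_size w) p ->
  exists2 T, exec (compile p) (input_store w) (run p (input_store w)) T &
    (T <= pol.[word_size w])%N.
Proof.
move=> tp; exists (ticks p * ('X + growth p + 2%N%:P)) => w lw.
set W := word_size w in lw *.
have wM b i : b != 1%N -> (input_store w b i <= 2 ^ W)%N.
  move=> _; rewrite /input_store; case: ifP => // _.
  have [iw|wi] := ltnP i (size w); last by rewrite nth_default.
  apply: leq_trans (ltnW (ltn_bits _)) _; rewrite leq_exp2l //.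
  by rewrite /W /word_size (big_nth 0%N) big_mkord (bigD1 (Ordinal iw)) //= leq_addr.
have M0 : (0 < 2 ^ W)%N by rewrite expn_gt0.
have [_ [T eT cT]] := exec_compile tp lw M0 (frefl _) wM (leqnn _).
exists T => //; apply: leq_trans cT _; rewrite !hornern leq_mul2l; apply/orP; right.
apply: leq_trans (bitsD _ _) _.
have b1 : (bits (2 ^ W) <= W.+1)%N by apply: bits_leq => //; rewrite ltn_exp2l.
have b2 : (bits (growth p).[W] <= (growth p).[W].+1)%N.
  by apply: bits_leq => //; apply: ltn_trans (ltnSn _) (ltn_expl _ _).
by lia.
Qed.

(** * The greedy program *)

Local Notation "x +$ y" := (Bin Add x y) (at level 50, left associativity).
Local Notation "x -$ y" := (Bin Defs.Sub x y) (at level 50, left associativity).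
Local Notation "x *$ y" := (Bin Mul x y) (at level 40, left associativity).
Local Notation "x /$ y" := (Bin Div x y) (at level 40, left associativity).

Lemma run_assign b ei ex s :
  run (PAssign b ei ex) s = update s b (eval s ei) (eval s ex).
Proof. by []. Qed.

Lemma run_seq p1 p2 s : run (PSeq p1 p2) s = run p2 (run p1 s).
Proof. by []. Qed.

Lemma run_if e p s : run (PIf e p) s = if eval s e == 0%N then s else run p s.
Proof. by []. Qed.

Arguments run : simpl never.

Definition count_loop v e c b ei : prog :=
  PSeq (PAssign b ei (Cst 0))
       (PFor v e (PIf c (PAssign b ei (Get b ei +$ Cst 1)))).

(** The loop writes to [b] and [v] as it runs, so index and condition are controlled in every store
    that agrees with [s] outside these banks. *)
Lemma run_count v e c b ei (P : nat -> bool) i0 s :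
  v != 0%N -> b != 0%N -> b != v -> input_only e ->
  (forall s', (forall b' i, b' != b -> b' != v -> s' b' i = s b' i) ->
     eval s' ei = i0) ->
  (forall s' k, (forall b' i, b' != b -> b' != v -> s' b' i = s b' i) ->
     (k < eval s e)%N -> s' v 0%N = k -> (eval s' c != 0%N) = P k) ->
  forall i, run (count_loop v e c b ei) s b i =
    if i == i0 then (\sum_(k < eval s e) P k)%N else s b i.
Proof.
move=> v0 b0 bv ie Hi Hc i; rewrite /count_loop run_seq run_assign; move: i.
have si : eval s ei = i0 by apply: Hi.
rewrite si; set s1 := update s b i0 0.
have Ee : eval s e = eval s1 e.
  by apply: eval_input_only => // i; rewrite /s1 update_other // eq_sym.
rewrite Ee in Hc *.
set body := PIf _ _.
apply: (@run_for v e body s1 (fun K s' => forall i,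
   s' b i = if i == i0 then (\sum_(k < K) P k)%N else s b i)).
- move=> i; rewrite update_other // /s1 /update eqxx /= big_ord0.
  by case: eqP.
- move=> k s' kN vk fr IH i.
  have fr' b' i' : b' != b -> b' != v -> s' b' i' = s b' i'.
    move=> bb bv'; rewrite fr //=; last by rewrite eq_sym.
    by rewrite /s1 update_other.
  rewrite update_other // run_if run_assign big_ord_recr /= -(Hc s') //.
  case: (eqVneq (eval s' c) 0%N) => _ /=; first by rewrite addn0 IH.
  rewrite (Hi s') // /update eqxx /= !IH !eqxx.
  by case: eqP.
Qed.

Lemma count_loop_writes v e c b ei b' :
  b' != b -> b' != v -> ~~ writes b' (count_loop v e c b ei).
Proof. by rewrite /= ![_ == b']eq_sym => /negbTE-> /negbTE->. Qed.

(** A pair of voter [i] and issue [j] is the cell number [i * n + j], held in bank 5; bank 6 holds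
    an admissible value. Truncated subtraction expresses comparison: [x - y] is nonzero iff [y < x].
    Products act as conjunctions and sums as disjunctions. [favor_] is the comparison with the
    threshold after clearing denominators. *)
Local Notation m_ := (Get 0 (Cst 0)).
Local Notation n_ := (Get 0 (Cst 1)).
Local Notation k_ := (Get 0 (Cst 2)).
Local Notation tn_ := (Get 0 (Cst 3)).
Local Notation td_ := (Get 0 (Cst 4)).
Local Notation target_ :=
  (Get 0 (Cst 5 +$ (Var 5 -$ (Var 5 /$ n_) *$ n_))).
Local Notation price_ :=
  (Get 0 (Cst 5 +$ n_ +$ Cst 2 *$ (m_ *$ n_) +$ Var 5 *$ (k_ +$ Cst 2) +$ Var 6)).
Local Notation favor_ :=
  (target_ *$ (Var 6 *$ td_ -$ tn_ *$ (k_ +$ Cst 1)) +$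
   (Cst 1 -$ target_) *$
     ((k_ +$ Cst 1 -$ Var 6) *$ td_ -$ tn_ *$ (k_ +$ Cst 1))).

(* Registers: 2 thresholds, 3 amounts, 4 numbers of favoring voters, 5-7 loop
   counters, 8 gain of the current pair, 9 best gain so far, 10 its pair.  The
   bound m (k + 2) / m vanishes for m = 0, when k is not polynomially bounded. *)
Definition threshold_table : prog :=
  PFor 5 (m_ *$ n_)
    (PSeq (PAssign 2 (Var 5) (Cst 0))
       (PFor 6 (m_ *$ (k_ +$ Cst 2) /$ m_)
          (PIf (favor_ *$ ((Cst 1 -$ Get 2 (Var 5)) +$
                           (Get 2 (Var 5) -$ (price_ +$ Cst 1))))
             (PAssign 2 (Var 5) (price_ +$ Cst 1))))).

Definition tally : prog :=
  PFor 5 n_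
    (count_loop 6 m_
       (Get 2 (Var 6 *$ n_ +$ Var 5) *$
          (Get 3 (Var 6) +$ Cst 2 -$ Get 2 (Var 6 *$ n_ +$ Var 5)))
       4 (Var 5)).

Local Notation cell_ := (Var 5 /$ n_ *$ n_ +$ Var 6).
Local Notation cost_ q := (Get 2 q -$ (Get 3 (q /$ n_) +$ Cst 1)).

(** Ratios of cost to gain are compared by cross-multiplication; 0 in bank 9 means that there is no
    candidate yet. *)
Definition select : prog :=
  PSeq (PAssign 9 (Cst 0) (Cst 0))
  (PFor 5 (m_ *$ n_)
    (PSeq
      (count_loop 6 n_
         ((m_ /$ Cst 2 +$ Cst 1 -$ Get 4 (Var 6)) *$
            (Get 2 cell_ -$ (Get 3 (Var 5 /$ n_) +$ Cst 1)) *$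
            (Get 2 (Var 5) +$ Cst 1 -$ Get 2 cell_))
         8 (Cst 0))
      (PIf (Var 8 *$ ((Cst 1 -$ Var 9) +$
              (cost_ (Var 10) *$ Var 8 -$ cost_ (Var 5) *$ Var 9)))
         (PSeq (PAssign 9 (Cst 0) (Var 8)) (PAssign 10 (Cst 0) (Var 5)))))).

Definition round : prog :=
  PSeq tally (PSeq select
    (PIf (Var 9) (PAssign 3 (Var 10 /$ n_) (Get 2 (Var 10) -$ Cst 1)))).

(** Bank 3 holds the amount available for each single issue, hence the factor [n_]. *)
Definition write_output : prog :=
  PFor 5 m_
    (PSeq (PAssign 1 (Var 5 +$ Var 5) (n_ *$ Get 3 (Var 5)))
          (PAssign 1 (Var 5 +$ Var 5 +$ Cst 1) (Cst 1))).

(** [m * n] rounds suffice: for feasible instances the initial demand is at most [m * n], and every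
    round with positive gain lowers it. *)
Definition greedy : prog :=
  PSeq threshold_table (PSeq (PFor 7 (m_ *$ n_) round) write_output).

Lemma greedy_tame : tame greedy. Proof. by []. Qed.

(** * Correctness of the threshold table *)

Section Table.

Variable f : nat -> nat.
Local Notation m := (f 0%N).
Local Notation n := (f 1%N).
Local Notation k := (f 2%N).

(** Kept in the form to which [favor_] evaluates; [favorableE] gives its meaning. *)
Definition favorable (p a : nat) : bool :=
  (f (5 + (p - p %/ n * n)) * (a * f 4 - f 3 * (k + 1)) +
   (1 - f (5 + (p - p %/ n * n))) * ((k + 1 - a) * f 4 - f 3 * (k + 1)) != 0)%N.

Definition price_of (p a : nat) : nat :=
  f (5 + n + 2 * (m * n) + p * (k + 2) + a)%N.

(* t = 0 means that no price suffices; otherwise the least one is t - 1. *)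
Definition threshold_upto (K p t : nat) : Prop :=
  (forall a, (a < K)%N -> favorable p a -> (0 < t <= (price_of p a).+1)%N) /\
  ((0 < t)%N -> exists a, [/\ (a < K)%N, favorable p a & t = (price_of p a).+1]).

Lemma run_threshold_table s : s 0%N =1 f ->
  forall p, (p < m * n)%N ->
    threshold_upto (m * (k + 2) %/ m) p (run threshold_table s 2%N p).
Proof.
move=> s0; rewrite /threshold_table; set body := PSeq _ _.
have := @run_for 5 (m_ *$ n_) body s (fun K s' =>
  forall p, (p < K)%N -> threshold_upto (m * (k + 2) %/ m) p (s' 2%N p)).
rewrite /= !s0; apply=> // p s' pN vp fr IH q.
have s'0 : s' 0%N =1 f by move=> i; rewrite fr.
rewrite update_other // ltnS leq_eqVlt => H.
rewrite /body run_seq run_assign [eval _ (Var 5)]/= vp [eval _ (Cst 0)]/=.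
set s1 := update s' 2%N p 0.
have s10 : s1 0%N =1 f by move=> i; rewrite /s1 update_other.
pose inner := PIf (favor_ *$ ((Cst 1 -$ Get 2 (Var 5)) +$
                           (Get 2 (Var 5) -$ (price_ +$ Cst 1))))
             (PAssign 2 (Var 5) (price_ +$ Cst 1)).
have := @run_for 6 (m_ *$ (k_ +$ Cst 2) /$ m_) inner s1
  (fun K s' => threshold_upto K p (s' 2%N p) /\
               forall q, q != p -> s' 2%N q = s1 2%N q).
case.
- split=> // ; rewrite update_other // /s1 update_same; split=> //.
- move=> a s2 aN va fr2 [[IH1 IH2] IH3].
  have s20 : s2 0%N =1 f by move=> i; rewrite fr2.
  have v5 : s2 5%N 0%N = p by rewrite fr2 // /s1 update_other.
  split; last first.
    move=> r rp; rewrite update_other // run_if; case: ifP => _; first exact: IH3.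
    by rewrite run_assign /= v5 /update (negbTE rp) /= IH3.
  rewrite update_other // run_if [eval _ _]/= v5 va !s20.
  rewrite -/(price_of p a) muln_eq0 -[X in X || _]negbK -/(favorable p a).
  have [Fa|nFa] /= := boolP (favorable p a); last first.
    split.
      move=> b; rewrite ltnS leq_eqVlt => /orP[/eqP->|/IH1 //].
      by rewrite (negbTE nFa).
    by move=> /IH2[b [bK Fb tb]]; exists b; split=> //; apply: ltnW.
  case: ifP => upd.
    have [t0 tp] : (0 < s2 2%N p)%N /\ (s2 2%N p <= (price_of p a).+1)%N.
      by move: upd => /eqP; lia.
    split.
      by move=> b; rewrite ltnS leq_eqVlt => /orP[/eqP-> _|/IH1//]; rewrite t0.
    by move=> /IH2[b [bK Fb tb]]; exists b; split=> //; apply: ltnW.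
  rewrite run_assign /= v5 va !s20 -/(price_of p a) update_same addn1; split.
    move=> b; rewrite ltnS leq_eqVlt => /orP[/eqP-> _|bK Fb]; first by rewrite leqnn.
    by have := IH1 b bK Fb; move: upd => /eqP; lia.
  by move=> _; exists a; split.
- rewrite /= !s10 => Hp Hq.
  move: H => /predU1P[->|qp]; first exact: Hp.
  rewrite Hq; last by rewrite neq_ltn qp.
  by rewrite /s1 /update eqxx /= (ltn_eqF qp); apply: IH.
Qed.

End Table.

(** * Correctness of the greedy rounds *)

Section Greedy.

Variables (m n : nat) (T X : nat -> nat).

(** [T p] is 0 or a least sufficient price plus 1, and [X i] is the amount per issue of voter [i];
    hence the comparison with the successor of [X]. *)
Definition covered (p : nat) : bool := (0 < T p <= (X (p %/ n)).+1)%N.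

Definition num_covered (j : nat) : nat := (\sum_(i < m) covered (i * n + j))%N.

(** Raising a voter to the threshold of [p] also covers his cells with smaller thresholds; only
    issues with unmet demand count. *)
Definition gain (p : nat) : nat :=
  (\sum_(j < n) ((num_covered j < (m./2).+1) &&
     ((X (p %/ n)).+1 < T (p %/ n * n + j) <= T p)))%N.

Definition increment (p : nat) : nat := (T p - (X (p %/ n)).+1)%N.

(** A relation, so that the analysis does not depend on how ties are broken. *)
Definition greedy_step (X' : nat -> nat) : Prop :=
  ((forall p, (p < m * n)%N -> gain p = 0%N) /\ X' =1 X) \/
  exists p, [/\ (p < m * n)%N, (0 < gain p)%N,
    forall q, (q < m * n)%N -> (increment p * gain q <= increment q * gain p)%N
    & X' =1 fun i => if i == (p %/ n)%N then (T p).-1 else X i].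

End Greedy.

Lemma tally_writes b : b \notin [:: 4; 5; 6] -> ~~ writes b tally.
Proof. by rewrite !inE !negb_or /= ![_ == b]eq_sym => /and3P[-> -> ->]. Qed.

Lemma select_writes b : b \notin [:: 5; 6; 8; 9; 10] -> ~~ writes b select.
Proof.
rewrite !inE !negb_or /= ![_ == b]eq_sym.
by move=> /and5P[/negbTE-> /negbTE-> /negbTE-> /negbTE-> /negbTE->].
Qed.

Lemma run_tally s j : (j < s 0 1)%N ->
  run tally s 4%N j = num_covered (s 0 0)%N (s 0 1)%N (s 2%N) (s 3%N) j.
Proof.
set m := s 0%N 0%N; set n := s 0%N 1%N.
rewrite /tally; set body := count_loop _ _ _ _ _.
have := @run_for 5 n_ body s (fun K s' => forall j,
  (j < K)%N -> (j < n)%N -> s' 4%N j = num_covered m n (s 2%N) (s 3%N) j).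
move=> H jn; apply: H => //= {j jn} k s' kN vk fr IH j jk jn.
have s'0 i : s' 0%N i = s 0%N i by rewrite fr.
rewrite update_other //.
rewrite (@run_count _ _ _ _ _
  (fun i => covered n (s 2%N) (s 3%N) (i * n + k)) k) //.
- rewrite /= s'0; case: eqP => [->//|/eqP jk'].
  by apply: IH => //; rewrite ltn_neqAle jk' -ltnS.
- by move=> s2 fr2; rewrite /= fr2.
- move=> s2 i fr2; rewrite /= s'0 => im vi.
  rewrite vi !fr2 //= !s'0 vk -/n !fr // /covered.
  rewrite divnMDl ?divn_small ?addn0; [|by lia..].
  by apply/idP/idP; nia.
Qed.

Lemma run_select s : let m := s 0%N 0%N in let n := s 0%N 1%N in
  (forall j, (j < n)%N -> s 4%N j = num_covered m n (s 2%N) (s 3%N) j) ->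
  let s' := run select s in
  let g := gain m n (s 2%N) (s 3%N) in let c := increment n (s 2%N) (s 3%N) in
  (s' 9%N 0%N = 0%N /\ forall p, (p < m * n)%N -> g p = 0%N) \/
  [/\ (s' 10%N 0%N < m * n)%N, (0 < s' 9 0)%N, s' 9%N 0%N = g (s' 10%N 0%N) &
    forall q, (q < m * n)%N -> (c (s' 10%N 0%N) * g q <= c q * g (s' 10%N 0%N))%N].
Proof.
move=> m n s4 s' g c; rewrite {}/s' /select run_seq run_assign.
set s1 := update s _ _ _; set body := PSeq _ _.
have s10 b i : b != 9%N -> s1 b i = s b i by move=> b9; rewrite /s1 update_other.
have := @run_for 5 (m_ *$ n_) body s1 (fun K s' =>
  (s' 9%N 0%N = 0%N /\ forall p, (p < K)%N -> g p = 0%N) \/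
  [/\ (s' 10%N 0%N < K)%N, (0 < s' 9 0)%N, s' 9%N 0%N = g (s' 10%N 0%N) &
    forall q, (q < K)%N -> (c (s' 10%N 0%N) * g q <= c q * g (s' 10%N 0%N))%N]).
rewrite [eval _ _]/= !s10 // -/m -/n; apply; first by left.
move=> p s2 pN vp fr IH; rewrite !update_other // /body run_seq.
have n0 : (0 < n)%N by rewrite lt0n; apply: contraTneq pN => ->; rewrite muln0.
have fr2 b i : b \notin [:: 5; 6; 8; 9; 10]%N -> s2 b i = s b i.
  rewrite !inE !negb_or => /and5P[b5 b6 b8 b9 b10].
  by rewrite fr //= ?s10 // ![_ == b]eq_sym !negb_or b6 b8 b9 b10.
set cnt := count_loop _ _ _ _ _; set s3 := run cnt s2.
have fr3 b i : b != 8%N -> b != 6%N -> s3 b i = s2 b i.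
  by move=> b8 b6; rewrite /s3 run_frame // count_loop_writes.
have g3 : s3 8%N 0%N = g p.
  rewrite /s3 /cnt (@run_count _ _ _ _ _ (fun j =>
    (num_covered m n (s 2%N) (s 3%N) j < (m./2).+1)%N &&
    ((s 3%N (p %/ n)).+1 < s 2%N (p %/ n * n + j) <= s 2%N p)%N) 0%N) //=.
    by rewrite fr2.
  move=> s' j frs; rewrite fr2 // => jn vj.
  rewrite vj !frs //= vp !fr2 //= s4 // -/m -/n divn2.
  by apply/idP/idP; nia.
have E q i : s3 3%N i = s 3%N i /\ s3 2%N q = s 2%N q /\ s3 0%N i = s 0%N i.
  by rewrite !fr3 // !fr2.
rewrite run_if; set cond := eval s3 _.
(* The candidate is kept iff [p] gains nothing or a candidate with a ratio no worse than that of [p]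
   exists. *)
have Ec : (cond == 0%N) = (g p == 0%N) ||
    ((s2 9%N 0%N != 0%N) && (c (s2 10 0)%N * g p <= c p * s2 9 0)%N).
  rewrite /cond /= g3 !fr3 //= vp !(fr2 0%N) // !(fr2 2%N) // !(fr2 3%N) //.
  rewrite -/n !addn1 /c /increment.
  by apply/idP/idP; nia.
rewrite Ec; case: ifPn => [|].
  rewrite !fr3 // => /orP[/eqP gp0|/andP[nz le]].
    case: IH => [[-> IH]|[pb gb gE IH]]; [left|right]; split=> //.
    + by move=> q; rewrite ltnS leq_eqVlt => /predU1P[->|/IH].
    + exact: ltnW.
    + move=> q; rewrite ltnS leq_eqVlt => /predU1P[->|/IH //].
      by rewrite gp0 muln0.
  case: IH => [[z _]|[pb gb gE IH]]; first by rewrite z in nz.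
  right; split=> //; first exact: ltnW.
  by move=> q; rewrite ltnS leq_eqVlt => /predU1P[->|/IH //]; rewrite -gE.
rewrite negb_or negb_and negbK -ltnNge => /andP[gp cmp].
right; rewrite run_seq !run_assign /= /update /= g3 fr3 // vp; split=> //.
  by rewrite lt0n.
move=> q; rewrite ltnS leq_eqVlt => /predU1P[-> //|qp].
case: IH => [[_ IH]|[pb gb gE IH]]; first by rewrite IH // muln0.
move: cmp; rewrite -leqn0 leqNgt gb /= => cmp.
have := IH q qp; rewrite -gE.
move: cmp gb; move: (s2 9%N 0%N) (c _) (c p) (c q) (g p) (g q).
clear=> gb cb cp cq gp gq cmp gb0 le.
(* Transitivity of ratios, [cp / gp < cb / gb <= cq / gq], with the middle denominator [gb]
   multiplied in. *)
rewrite -(leq_pmul2r gb0).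
apply: (@leq_trans (cb * gp * gq)%N).
  by rewrite mulnAC leq_mul2r ltnW ?orbT.
by rewrite mulnAC [leqRHS]mulnAC leq_mul2r le orbT.
Qed.

Lemma run_round s : (0 < s 0 1)%N ->
  greedy_step (s 0 0)%N (s 0 1)%N (s 2%N) (s 3%N) (run round s 3%N).
Proof.
move=> n0; rewrite /round run_seq [run (PSeq select _) _]run_seq.
set s1 := run tally s; set s2 := run select s1.
have E1 b : b \notin [:: 4; 5; 6]%N -> s1 b = s b.
  by move=> bn; apply/funext => i; rewrite /s1 run_frame // tally_writes.
have E2 b : b \notin [:: 5; 6; 8; 9; 10]%N -> s2 b = s1 b.
  by move=> bn; apply/funext => i; rewrite /s2 run_frame // select_writes.
have := @run_select s1; rewrite -/s2 (E1 0%N) // (E1 2%N) // (E1 3%N) //.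
move=> /(_ (@run_tally s)) sel.
rewrite run_if /=; move: sel => /= [[-> g0]|[pb g0 gE opt]].
  by left; split=> // i /=; rewrite E2 // E1.
right; exists (s2 10%N 0%N); rewrite -gE; split=> //; first by rewrite gE.
move=> i; rewrite (negbTE (lt0n_neq0 g0)) run_assign /update /= subn1.
by rewrite (E2 0%N) // (E2 2%N) // (E2 3%N) // (E1 0%N) // (E1 2%N) // (E1 3%N).
Qed.

(** Separates the machine from the analysis: below this point only [greedy_step] and the thresholds
    matter. *)
Lemma run_greedy s (I : nat -> (nat -> nat) -> Prop) :
  let f := s 0%N in let m := f 0%N in let n := f 1%N in let k := f 2%N in
  let T := run threshold_table s 2%N in
  (0 < n)%N -> I 0%N (s 3%N) ->
  (forall t X X', (t < m * n)%N -> I t X -> greedy_step m n T X X' -> I t.+1 X') ->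
  exists2 X, I (m * n)%N X & forall i, (i < m)%N ->
    run greedy s 1%N i.*2 = (n * X i)%N /\ run greedy s 1%N i.*2.+1 = 1%N.
Proof.
move=> f m n k T n0 I0 IS; rewrite /greedy run_seq [run (PSeq (PFor _ _ _) _) _]run_seq.
set s1 := run threshold_table s; set s2 := run (PFor _ _ _) s1.
have E1 b : b \notin [:: 2; 5; 6]%N -> s1 b = s b.
  rewrite !inE !negb_or => /and3P[/negbTE b2 /negbTE b5 /negbTE b6].
  apply/funext => i; rewrite /s1 run_frame //=.
  by rewrite ![_ == b]eq_sym b2 b5 b6.
exists (s2 3%N).
  have := @run_for 7 (m_ *$ n_) round s1 (fun t s' => I t (s' 3%N)).
  rewrite [eval _ _]/= !E1 // -/f -/m -/n; apply.
    rewrite (_ : update _ _ _ _ 3%N = s 3%N) //; apply/funext => i.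
    by rewrite update_other // E1.
  move=> t s' tN _ fr It; apply: IS tN It _.
  rewrite (_ : update _ _ _ _ 3%N = run round s' 3%N); last first.
    by apply/funext => i; rewrite update_other.
  have {}fr b : b \in [:: 0; 2]%N -> s' b = s1 b.
    by rewrite !inE => /orP[]/eqP->; apply/funext => i; rewrite fr.
  have := @run_round s'.
  by rewrite (fr 0%N) // (fr 2%N) // (E1 0%N) //; apply.
have E2 i : s2 0%N i = s 0%N i.
  by rewrite /s2 run_frame // E1.
move=> i im.
have := @run_for 5 m_ (PSeq (PAssign 1 (Var 5 +$ Var 5) (n_ *$ Get 3 (Var 5)))
          (PAssign 1 (Var 5 +$ Var 5 +$ Cst 1) (Cst 1))) s2 (fun K s' =>
   forall i, (i < K)%N -> s' 1%N i.*2 = (n * s2 3%N i)%N /\ s' 1%N i.*2.+1 = 1%N).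
rewrite [eval _ _]/= E2; apply=> // {i im} j s' jm vj fr IH i.
rewrite !update_other // run_seq !run_assign /= /update /= vj.
rewrite addnn addn1.
have dbl a b : (a.*2 == b.*2) = (a == b) by apply/eqP/eqP => [|->]; lia.
have dblS a b : (a.*2.+1 == b.*2) = false by apply/eqP; lia.
have dblS' a b : (a.*2 == b.*2.+1) = false by apply/eqP; lia.
rewrite eqSS !dbl dblS dblS'; case: eqP => [-> _|ij].
  by rewrite /= !fr // E2.
by rewrite ltnS leq_eqVlt => /predU1P[//|/IH].
Qed.

(** * Approximation ratio of greedy covering *)

Lemma divn_cell n i j : (j < n)%N -> ((i * n + j) %/ n = i)%N.
Proof.
by move=> jn; rewrite divnMDl ?(leq_ltn_trans _ jn) // divn_small // addn0.
Qed.

Lemma cell_bound m n i j : (i < m)%N -> (j < n)%N -> (i * n + j < m * n)%N.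
Proof. by move=> im jn; nia. Qed.

Section Analysis.

Variables (R : realType) (m n : nat) (T : nat -> nat) (Z : nat -> R).
Hypothesis n0 : (0 < n)%N.
Hypothesis Z0 : forall i, 0 <= Z i.

Local Notation h := (m./2).+1.
Local Notation num X := (num_covered m n T X).

Definition residual (X : nat -> nat) : nat := (\sum_(j < n) (h - num X j))%N.

(** [Z] stands for the amounts per issue of an arbitrary feasible solution. *)
Definition affordable (i j : nat) : bool :=
  (0 < T (i * n + j))%N && ((T (i * n + j)).-1%:R <= Z i).

Hypothesis Zfeas : forall j, (j < n)%N -> (h <= \sum_(i < m) affordable i j)%N.

Definition useful (X : nat -> nat) (i j : nat) : bool :=
  [&& (num X j < h)%N, ((X i).+1 < T (i * n + j))%N & affordable i j].

(** On an issue with unmet demand, [Z] wins at least [h] voters, and each of them is either covered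
    by [X] already or useful. *)
Lemma residual_useful X :
  (residual X <= \sum_(i < m) \sum_(j < n) useful X i j)%N.
Proof.
rewrite exchange_big; apply: leq_sum => j _.
case: (ltnP (num X j) h) => [lt|]; last by rewrite -subn_eq0 => /eqP->.
rewrite leq_subLR (leq_trans (Zfeas (ltn_ord j))) // /num_covered -big_split.
apply: leq_sum => i _; rewrite /covered /useful lt divn_cell //=.
by case: (boolP (affordable i j)) => // /andP[-> _]; rewrite andbT; case: leqP.
Qed.

(** Nestedness is used here: raising voter [i] to the largest threshold among his useful cells
    covers all of them and costs at most [Z i]. *)
Lemma useful_gain X i : (i < m)%N ->
  (\sum_(j < n) useful X i j = 0)%N \/
  exists p, [/\ (p < m * n)%N, (\sum_(j < n) useful X i j <= gain m n T X p)%N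
    & (increment n T X p)%:R <= Z i].
Proof.
move=> im; have [/existsP[j0 u0]|/existsPn nu] := boolP [exists j : 'I_n, useful X i j].
  right; have [j uj jmax] := @arg_maxnP _ j0 (fun j : 'I_n => useful X i j)
    (fun j => T (i * n + j)%N) u0.
  have pn := divn_cell i (ltn_ord j).
  exists (i * n + j)%N; split; first exact: cell_bound.
    apply: leq_sum => j' _; rewrite pn.
    have [/[dup] u /and3P[-> -> _] /=|//] := boolP (useful X i j').
    by have := jmax j' u; rewrite /geq /= => ->.
  have /and3P[_ _ /andP[_]] := uj; apply: le_trans.
  by rewrite /increment pn ler_nat; lia.
by left; apply: big1 => j _; rewrite (negbTE (nu j)).
Qed.

(* Averaging: raising every voter to his amount in the solution Z would cover
   the whole residual demand, so some voter does at least as well per unit. *)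
Lemma increment_residual X p :
  (forall q, (q < m * n)%N ->
     (increment n T X p * gain m n T X q <=
      increment n T X q * gain m n T X p)%N) ->
  (increment n T X p)%:R * (residual X)%:R <=
    (\sum_(i < m) Z i) * (gain m n T X p)%:R.
Proof.
move=> opt; set c := increment n T X p; set g := gain m n T X p.
apply: (@le_trans _ _ (c%:R * (\sum_(i < m) \sum_(j < n) useful X i j)%N%:R)).
  by rewrite ler_wpM2l ?ler_nat ?residual_useful.
rewrite natr_sum mulr_sumr mulr_suml; apply: ler_sum => i _.
have [->|[q [qmn uq cq]]] := useful_gain X (ltn_ord i).
  by rewrite mulr0 mulr_ge0.
apply: (@le_trans _ _ ((increment n T X q)%:R * g%:R)); last by rewrite ler_wpM2r.
rewrite -!natrM ler_nat; apply: leq_trans (opt q qmn).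
by rewrite leq_mul2l uq orbT.
Qed.

(** Greedy cannot get stuck: without any gain no cell is useful, so no demand is left. *)
Lemma residual0 X : (forall p, (p < m * n)%N -> gain m n T X p = 0%N) ->
  residual X = 0%N.
Proof.
move=> g0; apply/eqP; rewrite -leqn0 (leq_trans (residual_useful X)) // leqn0.
rewrite sum_nat_eq0; apply/forallP => i; apply/implyP => _.
have [->//|[p [pmn + _]]] := useful_gain X (ltn_ord i).
by rewrite g0 // leqn0.
Qed.

Lemma residual_step X X' p : (0 < gain m n T X p)%N ->
  X' =1 (fun i => if i == (p %/ n)%N then (T p).-1 else X i) -> (p < m * n)%N ->
  (residual X' + gain m n T X p <= residual X)%N /\
  (\sum_(i < m) X' i = \sum_(i < m) X i + increment n T X p)%N.
Proof.
move=> gp XE pmn; set i0 := (p %/ n)%N in XE.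
have im : (i0 < m)%N by rewrite ltn_divLR.
(* A positive gain forces the threshold of [p] above the current amount, so the update never lowers
   an amount. *)
have Xp : ((X i0).+1 < T p)%N.
  move: gp; rewrite lt0n sum_nat_eq0 => /forallPn[j]; rewrite negb_imply /=.
  by rewrite eqb0 negbK => /and3P[_ lt /(leq_trans lt)].
split; last first.
  rewrite (bigD1 (Ordinal im)) //= [X in (_ = X + _)%N](bigD1 (Ordinal im)) //=.
  rewrite XE eqxx; have -> : (\sum_(i < m | i != Ordinal im) X' i =
     \sum_(i < m | i != Ordinal im) X i)%N.
    by apply: eq_bigr => i; rewrite XE -val_eqE => /negbTE /= ->.
  by rewrite /increment -/i0; move: Xp; clear; move: (bigop _ _ _); lia.
rewrite /residual /gain -big_split; apply: leq_sum => j _ /=.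
set b := (_ && _).
have : (num X j + b <= num X' j)%N.
  rewrite /num_covered (bigD1 (Ordinal im)) //= [leqRHS](bigD1 (Ordinal im)) //=.
  rewrite addnAC leq_add //; last first.
    apply: leq_sum => i; rewrite -val_eqE /= => /negbTE ni.
    by rewrite /covered !divn_cell // XE ni.
  rewrite /covered divn_cell // XE eqxx /b -/i0.
  move: Xp; move: (num X j < _)%N (T (i0 * n + j)%N) (T p) (X i0) => u t tp x.
  clear; case: u => /=; lia.
by rewrite /b; case: (ltnP (num X j) h) => /=; lia.
Qed.

(** The first part bounds the number of rounds. The second is the telescoped cost bound; once
    nothing is left, the 1 in place of [- ln r] accounts for the last raise. *)
Definition greedy_inv (r0 t : nat) (X : nat -> nat) : Prop :=
  let r := residual X in
  ((0 < r)%N -> (r + t <= r0)%N) /\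
  (\sum_(i < m) X i)%N%:R <=
    (\sum_(i < m) Z i) * (ln r0%:R + if r == 0%N then 1 else - ln r%:R).

Lemma greedy_inv0 X : (forall i, X i = 0%N) -> greedy_inv (residual X) 0 X.
Proof.
move=> X0; split; first by rewrite addn0.
rewrite big1 => [|i _]; last exact: X0.
case: eqP => [->|_]; last by rewrite subrr mulr0.
(* With no initial demand, the default value 0 of [ln 0] leaves the bound [\sum_(i < m) Z i], which
   is nonnegative. *)
by rewrite ln0 // add0r mulr1 sumr_ge0.
Qed.

Lemma greedy_inv_step r0 t X X' :
  greedy_inv r0 t X -> greedy_step m n T X X' -> greedy_inv r0 t.+1 X'.
Proof.
set OPT := \sum_(i < m) Z i.
have OPT0 : 0 <= OPT by apply: sumr_ge0.
move=> [rt cX] [[g0 XE]|[p [pmn gp opt XE]]].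
  have -> : X' = X by apply/funext.
  by split=> //; rewrite (residual0 g0).
have [] := residual_step gp XE pmn; have := increment_residual opt.
rewrite /greedy_inv -/OPT in cX *.
move: rt cX gp; move: (increment n T X p) (gain m n T X p) => c g.
move: (residual X) (residual X') => r r' rt cX gp cr rr ->.
have r_gt0 : (0 < r)%N by lia.
split; first by have := rt r_gt0; lia.
rewrite (gtn_eqF r_gt0) in cX; rewrite natrD.
have r0R : 0 < r%:R :> R by rewrite ltr0n.
have cg : c%:R <= OPT * (g%:R / r%:R) by rewrite mulrA ler_pdivlMr.
apply: le_trans (lerD cX cg) _; rewrite -mulrDr ler_wpM2l // -addrA lerD2l.
(* If no demand remains, [g / r <= 1] and [ln r >= 0] are enough. *)
case: eqP => [_|/eqP r'0].
  have : 0 <= ln r%:R :> R by rewrite ln_ge0 // ler1n.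
  have : g%:R / r%:R <= 1 :> R by rewrite ler_pdivrMr // mul1r ler_nat; lia.
  lra.
have r'R : 0 < r'%:R :> R by rewrite ltr0n lt0n.
(* The inequality [ln x <= x - 1] at [x = r' / r] gives [g / r <= 1 - r' / r <= ln r - ln r']. *)
have : ln (r'%:R / r%:R) <= r'%:R / r%:R - 1 :> R.
  by rewrite -[X in ln X](addrNK 1) addrC le_ln1Dx //; have := divr_gt0 r'R r0R; lra.
rewrite ln_div // => H.
have : g%:R / r%:R <= 1 - r'%:R / r%:R :> R.
  rewrite -[X in X - _](@divff _ r%:R) ?gt_eqF // -mulrBl ler_pM2r ?invr_gt0 //.
  by rewrite -natrB ?ler_nat; lia.
lra.
Qed.

Lemma residual_leq X : (residual X <= m * n)%N.
Proof.
(* Without voters each issue would still demand [h = 1]; feasibility excludes this and gives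
   [h <= m]. *)
have m0 : (0 < m)%N.
  by have := Zfeas n0; case: (m) => //; rewrite big_ord0.
apply: (@leq_trans (\sum_(j < n) h)%N); first by apply: leq_sum => j _; lia.
by rewrite sum_nat_const card_ord mulnC leq_mul2r; apply/orP; right; lia.
Qed.

(** Demand left after [m * n] rounds would make the initial demand exceed [m * n]. *)
Lemma greedy_inv_final X0 X : greedy_inv (residual X0) (m * n) X ->
  (forall j, (j < n)%N -> (h <= num X j)%N) /\
  (\sum_(i < m) X i)%N%:R <= (\sum_(i < m) Z i) * (ln (residual X0)%:R + 1).
Proof.
case; case: (posnP (residual X)) => [r0 _|r0 /(_ isT)]; last first.
  by have := residual_leq X0; lia.
split=> // j jn; move/eqP: r0; rewrite sum_nat_eq0 => /forallP/(_ (Ordinal jn)).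
by rewrite /= subn_eq0.
Qed.

End Analysis.

(** * Voter bribery as a covering problem *)

Lemma nth_flatten_const (A : Type) (x0 : A) c (ss : seq (seq A)) p a :
  all (fun s => size s == c) ss -> (a < c)%N ->
  nth x0 (flatten ss) (p * c + a) = nth x0 (nth [::] ss p) a.
Proof.
move=> + ac; elim: ss p => [|s ss IH] p /=; first by rewrite !nth_nil.
move=> /andP[/eqP sc /IH{}IH]; rewrite nth_cat sc.
case: p => [|p] /=; first by rewrite mul0n ac.
by rewrite mulSn -addnA ltnNge leq_addr addKn IH.
Qed.

Lemma size_flatten_const (A : Type) c (ss : seq (seq A)) :
  all (fun s => size s == c) ss -> size (flatten ss) = (size ss * c)%N.
Proof.
elim: ss => [//|s ss IH] /= /andP[/eqP sc /IH{}IH].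
by rewrite size_cat sc IH mulSn.
Qed.

Lemma allpairs_flatten (A B C : Type) (F : A -> B -> C) s t :
  [seq F x y | x <- s, y <- t] = flatten [seq [seq F x y | y <- t] | x <- s].
Proof. by elim: s => //= x s ->. Qed.

(** * Reading the encoded instance *)

Section Link.

Variables (R : realType) (L : lobbying).

Local Notation m := (nvoters L).
Local Notation n := (nissues L).
Local Notation k := (level L).
Local Notation w := (encode_lobbying L).
Local Notation f := (input_store w 0%N).

Lemma all_size_allpairs (A B C : Type) (F : A -> B -> seq C) c s t :
  (forall x y, size (F x y) = c) ->
  all (fun u => size u == c) [seq F x y | x <- s, y <- t].
Proof.
move=> Fc; elim: s => //= x s IH; rewrite all_cat IH andbT.
by elim: t {IH} => //= y t IH; rewrite Fc eqxx.
Qed.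

Let targets := [seq nat_of_bool (target j) | j <- enum 'I_n].
Let probs := flatten [seq encode_rat (prob i j) | i <- enum 'I_m, j <- enum 'I_n].
Let prices := flatten [seq [seq price i j a | a <- enum 'I_k.+2]
                      | i <- enum 'I_m, j <- enum 'I_n].

Lemma encode_lobbyingE :
  w = [:: m; n; k; `|numq (threshold L)|; `|denq (threshold L)|]%N ++
      targets ++ probs ++ prices.
Proof. by []. Qed.

Lemma size_targets : size targets = n.
Proof. by rewrite size_map size_enum_ord. Qed.

Lemma size_probs : size probs = (2 * (m * n))%N.
Proof.
rewrite (@size_flatten_const _ 2); last exact: all_size_allpairs.
by rewrite size_allpairs !size_enum_ord mulnC.
Qed.

Lemma size_price_table i j : size [seq @price L i j a | a <- enum 'I_k.+2] = k.+2.
Proof. by rewrite size_map size_enum_ord. Qed.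

Lemma size_prices : size prices = (m * n * k.+2)%N.
Proof.
rewrite (@size_flatten_const _ k.+2) ?size_allpairs ?size_enum_ord //.
by apply: all_size_allpairs => i j; apply: size_price_table.
Qed.

Lemma encode_target (j : 'I_n) : f (5 + j)%N = target j.
Proof.
rewrite /input_store eqxx encode_lobbyingE nth_cat ltnNge leq_addr /= addKn.
rewrite nth_cat size_targets ltn_ord (nth_map j) ?size_enum_ord //.
by rewrite nth_ord_enum.
Qed.

Lemma encode_price (i : 'I_m) (j : 'I_n) (a : 'I_k.+2) :
  price_of f (i * n + j) a = price i j a.
Proof.
rewrite /price_of -[f 0%N]/(m) -[f 1%N]/(n) -[f 2%N]/(k) /input_store eqxx.
rewrite encode_lobbyingE.
set q := (i * n + j)%N; set pq := (q * _)%N; set sp := (2 * _)%N.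
rewrite -(addnA _ pq) -(addnA _ sp) -(addnA 5) nth_cat ltnNge leq_addr addKn.
rewrite nth_cat size_targets ltnNge leq_addr addKn.
rewrite nth_cat size_probs -/sp ltnNge leq_addr addKn [LHS]/=.
rewrite /pq addn2 (@nth_flatten_const _ _ k.+2) //; last first.
  by apply: all_size_allpairs => i' j'; apply: size_price_table.
rewrite allpairs_flatten /q (@nth_flatten_const _ _ n) //; last first.
  by apply/allP => u /mapP[x _ ->]; rewrite size_map size_enum_ord.
rewrite (nth_map i) ?size_enum_ord // (nth_map j) ?size_enum_ord //.
by rewrite (nth_map a) ?size_enum_ord // !nth_ord_enum.
Qed.

(** The explicit price table gives the word at least [m * n * k.+2] entries, each of at least one
    bit, which dominates the loop bounds. *)
Lemma greedy_loops_bounded : loops_bounded (input_store w) (word_size w) greedy.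
Proof.
have szW : (size w <= word_size w)%N.
  by rewrite /word_size -sum1_size; apply: leq_sum => x _; apply: bits_gt0.
have sz : size w = (5 + (n + (2 * (m * n) + m * n * k.+2)))%N.
  by rewrite encode_lobbyingE !size_cat size_targets size_probs size_prices.
have n0 := nissues_gt0 L.
have mn : (m <= m * n)%N by rewrite leq_pmulr.
have kmn : (m * (k + 2) %/ m <= m * n * k.+2)%N.
  case: (posnP m) => [->|m0]; first by rewrite mul0n div0n.
  by rewrite mulKn // addn2 leq_pmull // muln_gt0 m0.
move: szW; rewrite sz /= => szW.
by rewrite /input_store /=; repeat (apply/andP; split); lia.
Qed.

(** * Bribed voters and price thresholds *)

Definition favorable_value (j : 'I_n) (q : rat) : bool :=
  threshold L < (if target j then q else 1 - q).

Lemma threshold_fraction :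
  threshold L = `|numq (threshold L)|%:R / `|denq (threshold L)|%:R.
Proof.
have /andP[t0 _] := threshold01 L.
by rewrite -[LHS]divq_num_den !natr_absz !ger0_norm ?numq_ge0.
Qed.

Lemma favorableE (i : 'I_m) (j : 'I_n) (a : 'I_k.+2) :
  favorable f (i * n + j) a = favorable_value j (admissible a).
Proof.
rewrite /favorable (divn_cell i (ltn_ord j)) addKn encode_target.
have -> : f 2%N = k by []. have -> : f 3%N = `|numq (threshold L)|%N by [].
have -> : f 4%N = `|denq (threshold L)|%N by [].
rewrite /favorable_value [X in X < _]threshold_fraction /admissible.
set tn := `|numq _|%N; set td := `|denq _|%N.
have td0 : 0 < td%:R :> rat by rewrite ltr0n absz_gt0 denq_neq0.
have frac b : (tn%:R / td%:R < b%:R / k.+1%:R :> rat) = (tn * k.+1 < b * td)%N.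
  by rewrite ltr_pdivrMr // mulrAC ltr_pdivlMr ?ltr0n // -!natrM ltr_nat.
have ak : (a <= k.+1)%N by rewrite -ltnS.
have -> : 1 - a%:R / k.+1%:R = (k.+1 - a)%N%:R / k.+1%:R :> rat.
  by rewrite natrB // mulrBl divff ?pnatr_eq0.
rewrite addn1; case: target; rewrite /= frac ?subnn ?subn0 ?mul1n ?mul0n.
  by rewrite addn0 subn_eq0 ltnNge.
by rewrite add0n subn_eq0 ltnNge.
Qed.

(** With [k + 1] equal to [c] times the denominator, the index is [c] times the numerator. *)
Lemma admissible_prob (i : 'I_m) (j : 'I_n) :
  exists b : 'I_k.+2, admissible b = prob i j.
Proof.
have /andP[p0 p1] := prob01 i j; have /dvdzP[c cE] := level_denq i j.
have kd : k.+1%:R = c%:~R * (denq (prob i j))%:~R :> rat.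
  by rewrite -intrM -cE.
have d0' : (denq (prob i j))%:~R != 0 :> rat by rewrite intr_eq0 denq_neq0.
have c0 : c%:~R != 0 :> rat.
  by apply: contra_eq_neq kd => ->; rewrite mul0r pnatr_eq0.
have c_ge0 : 0 <= c by rewrite -(pmulr_lge0 c (denq_gt0 (prob i j))) -cE.
have E : (absz (c * numq (prob i j)))%:R / k.+1%:R = prob i j :> rat.
  rewrite natr_absz ger0_norm; last by rewrite mulr_ge0 ?numq_ge0.
  by rewrite kd intrM -mulf_div divff // mul1r divq_num_den.
have lt : (absz (c * numq (prob i j))%R < k.+2)%N.
  by rewrite ltnS -(ler_nat rat) -[leRHS]mul1r -ler_pdivrMr ?ltr0n // E.
by exists (Ordinal lt).
Qed.

(** The bribed value is the affordable one farthest towards the target, and moving that way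
    preserves favorability. The starting value [prob i j] of the maximum or minimum is itself
    admissible at price 0. *)
Lemma favors_bribed (d : 'I_m -> R) i j : 0 <= d i ->
  favors (bribed d) i j <->
  exists2 a, favorable_value j (admissible a) & (price i j a)%:R <= d i / n%:R.
Proof.
move=> d0; have dn0 : 0 <= d i / n%:R by rewrite divr_ge0.
have [b bE] := admissible_prob i j.
have prob_ok : favorable_value j (prob i j) ->
    exists2 a, favorable_value j (admissible a) & (price i j a)%:R <= d i / n%:R.
  by move=> fb; exists b; rewrite ?bE // price_prob.
rewrite /favors /bribed; split.
  have := prob_ok; rewrite /favorable_value; case: target => ok.
    rewrite ltNge => /bigmax_leP H; apply: contrapT => none; apply: H.
    split; first by rewrite leNgt; apply/negP => /ok.
    by move=> a pa; rewrite leNgt; apply/negP => ta; apply: none; exists a.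
  rewrite ltrBrDl -ltrBrDr ltNge => /bigmin_geP H.
  apply: contrapT => none; apply: H; split.
    by rewrite lerBlDr -lerBlDl leNgt; apply/negP => /ok.
  move=> a pa; rewrite lerBlDr -lerBlDl leNgt; apply/negP => ta.
  by apply: none; exists a.
move=> [a]; rewrite /favorable_value; case: target => fa pa.
  by apply: lt_le_trans fa _; apply: le_bigmax_cond.
by apply: lt_le_trans fa _; rewrite lerD2l lerN2; apply: bigmin_le_cond.
Qed.

Lemma num_favoringE (q : 'I_m -> 'I_n -> rat) j :
  num_favoring q j = (\sum_(i < m) favors q i j)%N.
Proof.
rewrite /num_favoring -sum1_card big_mkcond /=.
by apply: eq_bigr => i _; rewrite inE; case: favors.
Qed.

Lemma won_SME (q : 'I_m -> 'I_n -> rat) j :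
  won_SM q j <-> ((m./2).+1 <= num_favoring q j)%N.
Proof.
rewrite /won_SM ltr_pdivrMr // -natrM ltr_nat -{1}(odd_double_half m).
by case: (odd m); split; lia.
Qed.

Definition thresholds : nat -> nat := run threshold_table (input_store w) 2%N.

Lemma affordableE (d : 'I_m -> R) (Z : nat -> R) (i : 'I_m) (j : 'I_n) :
  0 <= d i -> Z i = d i / n%:R ->
  affordable n thresholds Z i j = favors (bribed d) i j.
Proof.
move=> d0 Zi; have pmn := cell_bound (ltn_ord i) (ltn_ord j).
have : threshold_upto f (m * (k + 2) %/ m) (i * n + j) (thresholds (i * n + j)).
  exact: (run_threshold_table (frefl f) pmn).
(* As there is a voter, the inner loop bound [m * (k + 2) %/ m] is [k + 2]: all admissible values
   were scanned. *)
have m0 : (0 < m)%N := leq_ltn_trans (leq0n i) (ltn_ord i).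
rewrite mulKn // addn2.
rewrite /affordable Zi; move: (thresholds _) => t [H1 H2].
apply/idP/idP => [/andP[t0 td]|].
  apply/favors_bribed => //; have [a [ak fa tE]] := H2 t0.
  exists (Ordinal ak); first by rewrite -(favorableE i).
  rewrite -(encode_price i j (Ordinal ak)).
  by move: td; rewrite tE.
move=> /(favors_bribed _ d0)[a fa pa].
have /andP[-> le] := H1 a (ltn_ord a) (etrans (favorableE _ _ _) fa).
apply: le_trans pa; rewrite ler_nat -(encode_price i j a).
by move: le; move: (price_of _ _ _); clear; lia.
Qed.

(* The junk value 0 past the last voter is never summed. *)
Definition share (d : 'I_m -> R) (i : nat) : R :=
  if insub i is Some i' then d i' / n%:R else 0.

Lemma shareE d (i : 'I_m) : share d i = d i / n%:R.
Proof. by rewrite /share valK. Qed.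

Lemma share_ge0 d i : (forall i, 0 <= d i) -> 0 <= share d i.
Proof. by move=> d0; rewrite /share; case: insub => // i'; rewrite divr_ge0. Qed.

Lemma VB_costE d : VB_cost d = n%:R * \sum_(i < m) share d i.
Proof.
rewrite mulr_sumr; apply: eq_bigr => i _.
by rewrite shareE mulrC divfK // pnatr_eq0 -lt0n nissues_gt0.
Qed.

Lemma won_SM_affordable d j : (forall i, 0 <= d i) ->
  won_SM (bribed d) j <->
  ((m./2).+1 <= \sum_(i < m) affordable n thresholds (share d) i j)%N.
Proof.
move=> d0; rewrite won_SME num_favoringE.
by under [X in (_ <= X)%N]eq_bigr => i _ do
  rewrite -(affordableE j (d0 i) (shareE d i)).
Qed.

Lemma coveredE (X : nat -> nat) (i : 'I_m) (j : 'I_n) :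
  covered n thresholds X (i * n + j) =
  affordable n thresholds (fun i => (X i)%:R : R) i j.
Proof.
rewrite /covered divn_cell // /affordable ler_nat.
by case: thresholds.
Qed.

(** A voter already in favor is covered at amount 0. Equality may fail, since a favorable value
    other than the current one can also have price 0. *)
Lemma residual_strict_cover :
  (residual m n thresholds (fun=> 0%N) <= strict_cover_number L)%N.
Proof.
apply: leq_sum => j _; rewrite leq_sub2l // num_favoringE.
apply: leq_sum => i _; rewrite coveredE.
rewrite (@affordableE (fun=> 0)) //; last by rewrite mul0r.
case: (boolP (favors _ _ _)) => // fav; rewrite lt0b.
have [b bE] := admissible_prob i j.
by apply/favors_bribed => //; exists b; rewrite ?bE // price_prob // mul0r.
Qed.

End Link.

Theorem theorem6p5 (R : realType) :
  poly_time_approximable (Q := Min_VB_SM R)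
    (fun L : lobbying => ln (strict_cover_number L)%:R + 1).
Proof.
have [pol polP] := prog_poly_time greedy_tame.
exists (compile greedy), pol => L.
have [T eT cT] := polP _ (greedy_loops_bounded L).
exists (run greedy (input_store (encode_lobbying L))), T; split=> // -[z [z0 zwon]].
have n0 := nissues_gt0 L.
set th := thresholds L; pose r0 := residual (nvoters L) (nissues L) th (fun=> 0%N).
have Z0 (d : solution L) : feasible d -> forall i, 0 <= share d i.
  by move=> [d0 _] i; apply: share_ge0.
have Zfeas (d : solution L) : feasible d -> forall j, (j < nissues L)%N ->
    ((nvoters L)./2.+1 <=
     \sum_(i < nvoters L) affordable (nissues L) th (share d) i j)%N.
  by move=> [d0 dwon] j jn; have /(won_SM_affordable _ d0) := dwon (Ordinal jn).
(* A single run is compared with all feasible solutions at once, so no optimum has to be chosen. *)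
pose inv t X := forall d : solution L, feasible d ->
  greedy_inv (nvoters L) (nissues L) th (share d) r0 t X.
have inv0 : inv 0%N (fun=> 0%N) by move=> d /Z0 d0; apply: greedy_inv0.
have [t X X' _ invX step d fd|X invX out] :=
    @run_greedy (input_store (encode_lobbying L)) inv n0 inv0.
  exact: (greedy_inv_step n0 (Z0 d fd) (Zfeas d fd) (invX d fd) step).
have fin d (fd : feasible d) := greedy_inv_final n0 (Zfeas d fd) (invX d fd).
set s := run _ _ in out *.
pose y (i : 'I_(nvoters L)) : R := (nissues L * X i)%N%:R.
have y0 i : 0 <= y i by [].
have yE (i : 'I_(nvoters L)) : share y i = (X i)%:R.
  by rewrite shareE /y natrM mulrAC divff ?mul1r // pnatr_eq0 -lt0n.
exists (mkseq (s 1%N) (nvoters L).*2), y; split.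
- by move=> i; rewrite size_mkseq => im; rewrite nth_mkseq.
- split; first by rewrite size_mkseq.
  move=> i; have [o1 o2] := out i (ltn_ord i).
  have im := ltn_ord i.
  by rewrite !nth_mkseq ?o1 ?o2 ?divr1 //; lia.
- split=> // j; apply/won_SM_affordable => //.
  have [+ _] := fin z (conj z0 zwon) => /(_ j (ltn_ord j)) won.
  apply: leq_trans won _; apply: leq_sum => i _; rewrite (coveredE R).
  by rewrite /affordable yE.
move=> d fd; have [_ le] := fin d fd.
rewrite /= !VB_costE mulrCA ler_wpM2l //.
under eq_bigr => i _ do rewrite yE.
rewrite -natr_sum (le_trans le) // mulrC ler_wpM2r ?sumr_ge0 //.
  by move=> i _; apply: Z0.
(* It remains to compare [ln r0] with [ln N] for [r0 <= N]; the zero cases use [ln 0 = 0] and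
   [ln N >= 0] for [N >= 1]. *)
rewrite lerD2r; have := residual_strict_cover R L; rewrite -/r0.
have [->|r0_gt0 rN] := posnP r0; last by rewrite ler_ln ?posrE ?ltr0n ?ler_nat //; lia.
rewrite ln0 //; have [->|N0] := posnP (strict_cover_number L); first by rewrite ln0.
by rewrite ln_ge0 // ler1n.
Qed.
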